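(* Let $\lambda={\stackrel{*}{\lambda}}+\widetilde\lambda\,i$ ($\widetilde\lambda\ne0$) be an eigenvalue with elementary divisor of multiplicity $m$ ($m\ge2$) of the matrix $B$ corresponding to the eigenvector $\nu^0={\stackrel{*}{\nu}}{}^0+\widetilde\nu{}^0i$ and to the generalized eigenvectors $\nu^k={\stackrel{*}{\nu}}{}^k+\widetilde\nu{}^ki$ of order $k$, $k=1,\ldots,m-1$. Then the system of ordinary differential equations $\dfrac{dx}{dt}=Ax+f(t)$ has the first integrals $$F_{\tau,k+1}\colon(t,x)\to\alpha_{\tau k}(t,x)-\sum_{\xi=0}^{k-1}\binom k\xi t^{k-\xi}F_{\tau,\xi+1}(t,x)-G_{\tau k}(t)\quad\text{for all }(t,x)\in\widetilde J\times\mathbb R^n,\quad k=1,\ldots,m-1,\ \tau=1,2,$$ where $\widetilde J\subset J$ is an interval, $$\alpha_{1k}(t,x)=\bigl({\stackrel{*}{\nu}}{}^kx\cos\widetilde\lambda t+\widetilde\nu{}^kx\sin\widetilde\lambda t\bigr)e^{-{\stackrel{*}{\lambda}}t},\qquad\alpha_{2k}(t,x)=\bigl(\widetilde\nu{}^kx\cos\widetilde\lambda t-{\stackrel{*}{\nu}}{}^kx\sin\widetilde\lambda t\bigr)e^{-{\stackrel{*}{\lambda}}t}$$ for all $(t,x)\in\mathbb R^{n+1}$, $k=0,\ldots,m-1$; $G_{\tau k}$ is the iterated integral defined recursively by $$G_{\tau0}(t)=\int\alpha_{\tau0}(t,f(t))\,dt,\qquad G_{\tau k}(t)=\int\bigl(\alpha_{\tau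 k}(t,f(t))+k\,G_{\tau,k-1}(t)\bigr)dt,\quad k=1,\ldots,m-1;$$ and $F_{\tau1}$, $\tau=1,2$, are the first integrals $$F_{\tau1}\colon(t,x)\to\alpha_{\tau0}(t,x)-G_{\tau0}(t)\quad\text{for all }(t,x)\in\widetilde J\times\mathbb R^n.$$
   Context: $A$ is a real $n\times n$ matrix, $B=A^T$, $x\in\mathbb R^n$, and $f\colon J\to\mathbb R^n$ is continuous on an interval $J\subset\mathbb R$. For vectors, $\nu x=\sum_{i=1}^n\nu_ix_i$. A star over a symbol denotes the real part and a tilde the imaginary part. If $\nu^0$ is an eigenvector of $B$ for the eigenvalue $\lambda$ with elementary divisor of multiplicity $m$, a nonzero vector $\nu^k\in\mathbb C^n$ is a generalized eigenvector of order $k$ for $\lambda$ if $(B-\lambda E)\nu^k=k\,\nu^{k-1}$, $k=1,\ldots,m-1$ ($E$ the identity matrix). Indefinite integrals denote antiderivatives on $\widetilde J$, each $G_{\tau k}$ being chosen once and used throughout. A continuously differentiable function $F(t,x)$ is a first integral of $dx/dt=Ax+f(t)$ if $\partial_tF+\sum_{i=1}^n(Ax+f(t))_i\,\partial_{x_i}F=0$ on its domain. *)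

(* Defs.v *)
From HB Require Import structures.
From mathcomp Require Export all_boot all_order all_algebra.
From mathcomp Require Export all_classical all_reals all_analysis.
From mathcomp Require Export complex.
Export Order.TTheory GRing.Theory Num.Theory numFieldNormedType.Exports.

#[export] Set Implicit Arguments.
#[export] Unset Strict Implicit.
#[export] Unset Printing Implicit Defensive.

Open Scope classical_set_scope.
Open Scope ring_scope.

(** * Elementary divisors *)

(* The gcd of all minors of order [k] of ['X - M].  The gcd runs over all index
   maps, not only the increasing ones: a non-injective map gives a zero minor
   and a reordering only changes the sign. *)
Definition determinantal_divisor (K : fieldType) (n : nat) (M : 'M[K]_n)
    (k : nat) : {poly K} :=
  \big[@gcdp K/0]_(r : {ffun 'I_k -> 'I_n})
    \big[@gcdp K/0]_(c : {ffun 'I_k -> 'I_n})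
      \det (mxsub r c (char_poly_mx M)).

(* [k] counts from 0, so that the invariant factors are those with [k < n]; they
   are defined up to a nonzero constant. *)
Definition invariant_factor (K : fieldType) (n : nat) (M : 'M[K]_n)
    (k : nat) : {poly K} :=
  determinantal_divisor M k.+1 %/ determinantal_divisor M k.

(* [('X - a) ^ m] is an elementary divisor of [M]: the exact power of
   ['X - a] dividing one of the invariant factors. *)
Definition has_elementary_divisor (K : fieldType) (n : nat) (M : 'M[K]_n)
    (a : K) (m : nat) : Prop :=
  (0 < m)%N /\ exists2 k : nat, (k < n)%N & mup a (invariant_factor M k) = m.

(** * Eigenvectors (as columns) *)

Definition is_eigenvector (K : fieldType) (n : nat) (M : 'M[K]_n) (a : K)
    (v : 'cV[K]_n) : Prop :=
  v != 0 /\ M *m v = a *: v.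

(* The factor [k] is part of the convention, unlike in a usual Jordan chain. *)
Definition is_generalized_eigenvector (K : fieldType) (n : nat) (M : 'M[K]_n)
    (a : K) (nu : nat -> 'cV[K]_n) (k : nat) : Prop :=
  nu k != 0 /\ (M - a%:M) *m nu k = k%:R *: nu k.-1.

Definition cmx_of_rmx (R : realType) (p q : nat) (M : 'M[R]_(p, q)) :
    'M[R[i]]_(p, q) :=
  map_mx (real_complex R) M.

(** * Calculus on an interval *)

Definition nondegenerate_interval (R : realType) (D : set R) : Prop :=
  is_interval D /\ exists a b : R, [/\ a < b, D a & D b].

(* Derivatives relative to [D]: ordinary ones at the interior points of the
   interval [D], one-sided ones at the end points belonging to [D]. *)
Definition derivable_on (R : realType) (D : set R) (g : R -> R) (t : R) : Prop :=
  cvg ((fun s => (g s - g t) / (s - t)) @ within D t^').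

Definition derive_on (R : realType) (D : set R) (g : R -> R) (t : R) : R :=
  lim ((fun s => (g s - g t) / (s - t)) @ within D t^').

Definition is_antiderivative_on (R : realType) (D : set R) (g G : R -> R) : Prop :=
  forall t : R, D t -> derivable_on D G t /\ derive_on D G t = g t.

Definition pderive (R : realType) (n : nat) (F : R -> 'cV[R]_n -> R) (i : 'I_n)
    (t : R) (x : 'cV[R]_n) : R :=
  'D_(delta_mx i 0) (F t) x.

Definition continuously_differentiable_on (R : realType) (n : nat) (D : set R)
    (F : R -> 'cV[R]_n -> R) : Prop :=
  [/\ forall t x, D t -> derivable_on D (F^~ x) t,
      forall t x i, D t -> derivable (F t) x (delta_mx i 0),
      {within D `*` [set: 'cV[R]_n],
         continuous (fun p : R * 'cV[R]_n => derive_on D (F^~ p.2) p.1)} &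
      forall i, {within D `*` [set: 'cV[R]_n],
         continuous (fun p : R * 'cV[R]_n => pderive F i p.1 p.2)}].

(* First integral, with domain [D * R^n], of the system [dx/dt = A x + f t]. *)
Definition is_first_integral (R : realType) (n : nat) (A : 'M[R]_n)
    (f : R -> 'cV[R]_n) (D : set R) (F : R -> 'cV[R]_n -> R) : Prop :=
  continuously_differentiable_on D F /\
  forall (t : R) (x : 'cV[R]_n), D t ->
    derive_on D (F^~ x) t
      + \sum_(i < n) (A *m x + f t) i 0 * pderive F i t x = 0.

(** * The functions alpha *)

Definition dotv (R : realType) (n : nat) (u x : 'cV[R]_n) : R :=
  \sum_(i < n) u i 0 * x i 0.

Definition re_cV (R : realType) (n : nat) (v : 'cV[R[i]]_n) : 'cV[R]_n :=
  map_mx (@complex.Re R) v.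

Definition im_cV (R : realType) (n : nat) (v : 'cV[R[i]]_n) : 'cV[R]_n :=
  map_mx (@complex.Im R) v.

Definition alpha1 (R : realType) (n : nat) (lambda : R[i])
    (nu : nat -> 'cV[R[i]]_n) (k : nat) (t : R) (x : 'cV[R]_n) : R :=
  (dotv (re_cV (nu k)) x * cos (complex.Im lambda * t)
     + dotv (im_cV (nu k)) x * sin (complex.Im lambda * t))
  * expR (- complex.Re lambda * t).

Definition alpha2 (R : realType) (n : nat) (lambda : R[i])
    (nu : nat -> 'cV[R[i]]_n) (k : nat) (t : R) (x : 'cV[R]_n) : R :=
  (dotv (im_cV (nu k)) x * cos (complex.Im lambda * t)
     - dotv (re_cV (nu k)) x * sin (complex.Im lambda * t))
  * expR (- complex.Re lambda * t).

(* The elements 0 and 1 of ['I_2] stand for tau = 1 and tau = 2. *)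
Definition alpha (R : realType) (n : nat) (lambda : R[i])
    (nu : nat -> 'cV[R[i]]_n) (tau : 'I_2) : nat -> R -> 'cV[R]_n -> R :=
  if tau == ord0 then alpha1 lambda nu else alpha2 lambda nu.

(* Main.v *)
Require Import Defs.
From mathcomp Require Import ring lra.

(** Let [L F = dF/dt + (A x + f t) . dF/dx] be the derivative of [F] along the
    system, so that a first integral is a continuously differentiable [F] with
    [L F = 0].  [L] is a derivation, which reduces the theorem to algebra.

    The chain relation [(A^T - lambda) nu_k = k nu_(k-1)] says that
    [z_k(t, x) = (nu_k . x) exp(- lambda t)] satisfies
    [L z_k = k z_(k-1) + z_k(t, f t)].  The functions alpha_1k and alpha_2k are
    the real and imaginary parts of [z_k], hence satisfy the same equation
    ([total_derivative_alpha]).  The recursion defining [G_k] is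
    [L G_k = k G_(k-1) + alpha_k(t, f t)], so the inhomogeneous term cancels in
    [H_k = alpha_k - G_k]: [L H_k = k H_(k-1)].

    This is the relation of an Appell sequence, like that of the powers [t ^ k].
    The recursion for [F] amounts to
    [H_k = \sum_(j <= k) 'C(k, j) t ^ (k - j) F_(j+1)], the expansion of an
    Appell sequence over its constants, so [L F_(k+1) = 0] follows by induction
    on [k] ([appell_first_integrals]).

    The analytic content is that [L] exists and is a derivation on functions
    over [D * R^n] when the time interval [D] may contain its end points, where
    time derivatives are one-sided.  [has_total_derivative] packages the
    regularity together with the value of [L F]; it is shown to be stable under
    sums and products and to hold for linear forms and for functions of time. *)

(** * Derivatives relative to an interval *)

Definition has_derivative_on (R : realType) (D : set R) (g : R -> R)
    (t l : R) : Prop :=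
  (fun s => (g s - g t) / (s - t)) @ within D t^' --> l.

Section RelativeDerivative.
Context {R : realType} {D : set R}.
Implicit Types (g h : R -> R) (t l : R).

(** Relative derivatives are unique because every point of a nondegenerate
    interval is a limit of other points of the interval: move slightly towards
    an element [c] of [D] distinct from [t]. *)
Lemma within_dnbhs_proper t : nondegenerate_interval D -> D t ->
  ProperFilter (within D t^').
Proof.
move=> [Ditv [a [b [ab Da Db]]]] Dt.
have [c Dc tc] : exists2 c, D c & c != t.
  have [->|?] := eqVneq t a; last by exists a => //; rewrite eq_sym.
  by exists b => //; rewrite gt_eqF.
apply: Build_ProperFilter_ex => P /nbhs_ballP[e /= e0 eP].
have ct0 : 0 < `|c - t| by rewrite normr_gt0 subr_eq0.
(* The step [d] keeps [t + d (c - t)] both between [t] and [c] and within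
   distance [e] of [t]. *)
pose d := Num.min 1 (e / 2 / `|c - t|).
have d0 : 0 < d by rewrite lt_min ltr01 /= !divr_gt0.
have d1 : d <= 1 by rewrite ge_min lexx.
have de : d * `|c - t| < e.
  apply: (@le_lt_trans _ _ (e / 2)); last by lra.
  by rewrite -ler_pdivlMr // ge_min lexx orbT.
exists (t + d * (c - t)); apply: eP.
- by rewrite /ball /= opprD addrA subrr sub0r normrN normrM gtr0_norm.
- by rewrite -subr_eq0 [t + _]addrC addrK mulf_neq0 ?subr_eq0 // gt_eqF.
- have [tlec|clet] := leP t c.
    by apply: (Ditv t c) => //; nra.
  by apply: (Ditv c t) => //; nra.
Qed.

Lemma has_derivative_on_derivable g t l : nondegenerate_interval D -> D t ->
  has_derivative_on D g t l -> derivable_on D g t /\ derive_on D g t = l.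
Proof.
move=> Dnd Dt gl; have PF := within_dnbhs_proper Dnd Dt.
by split; [apply/cvg_ex; exists l | exact/cvg_lim].
Qed.

Lemma antiderivative_has_derivative_on g h t : is_antiderivative_on D g h ->
  D t -> has_derivative_on D h t (g t).
Proof. by move=> gh Dt; have [h1 <-] := gh t Dt. Qed.

Lemma is_derive_has_derivative_on g t l :
  is_derive t 1 g l -> has_derivative_on D g t l.
Proof.
move=> [dg <-]; apply: cvg_within_filter.
have shift0 : (fun s => s - t) @ t^' --> (0:R)^'.
  rewrite -(subrr t); apply: (@continuous_injective_withinNx _ _ (fun s => s - t)).
    by apply: cvgB; [exact: cvg_id|exact: cvg_cst].
  by move=> s; exact: addIr.
rewrite (_ : (fun s => _) = (fun u => u^-1 *: ((g \o shift t) (u *: 1) - g t))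
    \o (fun s => s - t)).
  by apply: cvg_comp shift0 _; exact: dg.
by apply/funext => s /=; rewrite scaler1 subrK mulrC.
Qed.

Lemma has_derivative_on_ext g h t l : D t -> (forall s, D s -> g s = h s) ->
  has_derivative_on D g t l -> has_derivative_on D h t l.
Proof.
move=> Dt gh; apply: cvg_trans; apply: fmap_within_eq => s /set_mem Ds.
by rewrite !gh.
Qed.

Lemma has_derivative_onD g h t lg lh : has_derivative_on D g t lg ->
  has_derivative_on D h t lh -> has_derivative_on D (g \+ h) t (lg + lh).
Proof.
move=> dg dh; rewrite /has_derivative_on.
rewrite (_ : (fun s => _) = (fun s => (g s - g t) / (s - t)) \+
  (fun s => (h s - h t) / (s - t))); first exact: cvgD.
by apply/funext => s /=; ring.
Qed.

Lemma within_dnbhs_sub t : within D t^' `=>` within D (nbhs t).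
Proof. by move=> P; rewrite /within /dnbhs /=; apply: filterS => s + _. Qed.

Lemma has_derivative_onM g h t lg lh :
  g @ within D (nbhs t) --> g t ->
  has_derivative_on D g t lg -> has_derivative_on D h t lh ->
  has_derivative_on D (g \* h) t (lg * h t + g t * lh).
Proof.
move=> cg dg dh; rewrite /has_derivative_on.
rewrite (_ : (fun s => _) = (fun s => (g s - g t) / (s - t) * h t +
  g s * ((h s - h t) / (s - t)))); last by apply/funext => s /=; ring.
apply: cvgD; first by apply: cvgM => //; exact: cvg_cst.
apply: cvgM => //; apply: cvg_trans cg; apply: cvg_app.
exact: within_dnbhs_sub.
Qed.

(** Near [t], [g s] is [g t] plus the difference quotient times [s - t]. *)
Lemma has_derivative_on_continuous g t l : D t -> has_derivative_on D g t l ->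
  g @ within D (nbhs t) --> g t.
Proof.
move=> Dt dg.
have st0 : (fun s => s - t) @ t --> t - t.
  by apply: cvgB; [exact: cvg_id|exact: cvg_cst].
have cg : (fun s => g t + (g s - g t) / (s - t) * (s - t)) @ within D t^'
    --> g t + l * (t - t).
  apply: cvgD; [exact: cvg_cst|apply: cvgM => //].
  by apply: cvg_within_filter; exact: cvg_within_filter.
rewrite subrr mulr0 addr0 in cg.
move=> P Pg; have {}cg : \forall s \near t, s != t -> D s ->
  P (g t + (g s - g t) / (s - t) * (s - t)) := cg _ Pg.
change (\forall s \near t, D s -> P (g s)); apply: filterS cg => s + Ds.
have [-> _|st /(_ isT Ds)] := eqVneq s t.
  exact: nbhs_singleton Pg.
by rewrite divfK ?subr_eq0// addrC subrK.
Qed.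

End RelativeDerivative.

(** * Linear forms *)

Section LinearForms.
Context {R : realType} {n : nat}.
Implicit Types (w p q x y : 'cV[R]_n) (a mu : R).

Lemma dotvDr (w x y : 'cV[R]_n) : dotv w (x + y) = dotv w x + dotv w y.
Proof.
by rewrite /dotv -big_split; apply: eq_bigr => i _; rewrite mxE mulrDr.
Qed.

Lemma dotvZr (w x : 'cV[R]_n) a : dotv w (a *: x) = a * dotv w x.
Proof.
by rewrite /dotv mulr_sumr; apply: eq_bigr => i _; rewrite mxE mulrCA.
Qed.

Lemma continuous_dotv (w : 'cV[R]_n) : continuous (dotv w).
Proof.
rewrite /dotv => x; have FF : Filter (nbhs x) by exact: nbhs_filter.
apply: (@cvg_big _ _ _ _ _ add_continuous _ _ _ _ _ FF) => i _.
by apply: cvgM; [exact: cvg_cst|exact: coord_continuous].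
Qed.

Lemma is_derive_dotv (w x v : 'cV[R]_n) : is_derive x v (dotv w) (dotv w v).
Proof.
have dw : (fun h => h^-1 *: ((dotv w \o shift x) (h *: v) - dotv w x)) @ 0^'
    --> dotv w v.
  apply: (@cvg_trans _ ((fun=> dotv w v) @ 0^')); last exact: cvg_cst.
  apply: near_eq_cvg; near=> h => /=.
  rewrite dotvDr dotvZr addrK /GRing.scale /= mulKf //.
  near: h; exact: nbhs_dnbhs_neq.
by split; [apply/cvg_ex; exists (dotv w v) | exact/cvg_lim].
Unshelve. all: by end_near.
Qed.

Lemma dotvC w x : dotv w x = dotv x w.
Proof. by apply: eq_bigr => i _; rewrite mulrC. Qed.

Lemma dotvDl w p x : dotv (w + p) x = dotv w x + dotv p x.
Proof. by rewrite dotvC dotvDr !(dotvC x). Qed.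

Lemma dotvZl w x a : dotv (a *: w) x = a * dotv w x.
Proof. by rewrite dotvC dotvZr dotvC. Qed.

Lemma dotvNl w x : dotv (- w) x = - dotv w x.
Proof. by rewrite -scaleN1r dotvZl mulN1r. Qed.

Lemma dotv_mulmx (A : 'M[R]_n) w x : dotv w (A *m x) = dotv (A^T *m w) x.
Proof.
have dotvE (u v : 'cV[R]_n) : dotv u v = (u^T *m v) 0 0.
  by rewrite mxE; apply: eq_bigr => i _; rewrite mxE.
by rewrite !dotvE trmx_mul trmxK mulmxA.
Qed.

(** A common form for the two families alpha: with [nu = u + i v], the pair
    [(p, q) = (u, v)] gives alpha1 and the pair [(v, - u)] gives alpha2. *)
Definition rotating_form a mu p q (t : R) x : R :=
  (dotv p x * cos (mu * t) + dotv q x * sin (mu * t)) * expR (- a * t).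

End LinearForms.

(** * The derivative along the system *)

Section TotalDerivative.
Context {R : realType} {n : nat} (A : 'M[R]_n) (f : R -> 'cV[R]_n) (D : set R).
Implicit Types (F H K L : R -> 'cV[R]_n -> R).

Definition jointly_continuous_on F : Prop :=
  {within D `*` [set: 'cV[R]_n], continuous (fun p => F p.1 p.2)}.

(** The partial derivatives are given as witnesses rather than through
    [derive_on] and [pderive], which makes closure under the ring operations
    immediate.  The continuity of [F] itself is part of the notion because the
    partial derivatives of a product involve its factors. *)
Definition has_total_derivative F L : Prop :=
  jointly_continuous_on F /\
  exists (Ft : R -> 'cV[R]_n -> R) (Fx : 'I_n -> R -> 'cV[R]_n -> R),
  [/\ forall t x, D t -> has_derivative_on D (F^~ x) t (Ft t x),
      forall t x i, D t -> is_derive x (delta_mx i 0) (F t) (Fx i t x),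
      jointly_continuous_on Ft,
      forall i, jointly_continuous_on (Fx i) &
      forall t x, D t ->
        L t x = Ft t x + \sum_(i < n) (A *m x + f t) i 0 * Fx i t x].

Lemma jointly_continuous_on_ext F H : (forall t x, D t -> F t x = H t x) ->
  jointly_continuous_on F -> jointly_continuous_on H.
Proof.
move=> FH; apply: subspace_eq_continuous => p /set_mem[Dp _].
exact: FH.
Qed.

Lemma jointly_continuous_onD F H :
  jointly_continuous_on F -> jointly_continuous_on H ->
  jointly_continuous_on (fun t x => F t x + H t x).
Proof. by move=> cF cH p; apply: cvgD; [exact: cF|exact: cH]. Qed.

Lemma jointly_continuous_onM F H :
  jointly_continuous_on F -> jointly_continuous_on H ->
  jointly_continuous_on (fun t x => F t x * H t x).
Proof. by move=> cF cH p; apply: cvgM; [exact: cF|exact: cH]. Qed.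

Lemma jointly_continuous_on_cst c : jointly_continuous_on (fun _ _ => c).
Proof. by move=> p; exact: cvg_cst. Qed.

Lemma jointly_continuous_on_time (g : R -> R) : {within D, continuous g} ->
  jointly_continuous_on (fun t _ => g t).
Proof.
move=> /subspace_continuousP cg; apply/subspace_continuousP => -[t x] [/= Dt _].
move=> P /(cg t Dt) Pt; have {}Pt : \forall s \near t, D s -> P (g s) := Pt.
have tx : (fun p : R * 'cV[R]_n => p.1) @ (t, x) --> t by exact: cvg_fst.
change (\forall p \near (t, x), (D `*` [set: 'cV[R]_n]) p -> P (g p.1)).
have : \forall p \near (t, x), D p.1 -> P (g p.1) := tx _ Pt.
by apply: filterS => p /= + [Dp _]; apply.
Qed.

Lemma graph_continuous F (g : R -> 'cV[R]_n) : jointly_continuous_on F ->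
  {within D, continuous g} -> {within D, continuous (fun t => F t (g t))}.
Proof.
move=> /subspace_continuousP cF /subspace_continuousP cg.
apply/subspace_continuousP => t Dt P /(cF (t, g t) (conj Dt I)) Pt.
have {}Pt : \forall p \near (t, g t), (D `*` [set: 'cV[R]_n]) p ->
  P (F p.1 p.2) := Pt.
have tg : (fun s => (s, g s)) @ within D (nbhs t) --> (t, g t).
  apply: (@cvg_pair _ _ _ (within D (nbhs t)) (nbhs t) (nbhs (g t)) _ _ _ id g).
    exact: cvg_within.
  exact: cg.
have : \forall s \near t, D s -> (D `*` [set: 'cV[R]_n]) (s, g s) ->
  P (F s (g s)) := tg _ Pt.
by apply: filterS => s + Ds; apply.
Qed.

Lemma total_derivative_ext F H L K :
  (forall t x, D t -> F t x = H t x) -> (forall t x, D t -> L t x = K t x) ->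
  has_total_derivative F L -> has_total_derivative H K.
Proof.
move=> FH LK [cF [Ft [Fx [Ft_der Fx_der cFt cFx eqL]]]].
split; first exact: jointly_continuous_on_ext cF.
exists Ft, Fx; split=> // t x; last by move=> Dt; rewrite -LK ?eqL.
  move=> Dt; apply: has_derivative_on_ext (Ft_der t x Dt) => // s.
  exact: FH.
move=> i Dt; rewrite -(_ : F t = H t); first exact: Fx_der.
by apply/funext => y; exact: FH.
Qed.

Lemma total_derivative_cst c : has_total_derivative (fun _ _ => c) (fun _ _ => 0).
Proof.
split; first exact: jointly_continuous_on_cst.
exists (fun _ _ => 0), (fun _ _ _ => 0); split=> [t x Dt|t x i Dt|||t x Dt].
- by apply: is_derive_has_derivative_on; exact: is_derive_cst.
- exact: is_derive_cst.
- exact: jointly_continuous_on_cst.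
- by move=> i; exact: jointly_continuous_on_cst.
- by rewrite big1 ?addr0 // => i _; rewrite mulr0.
Qed.

Lemma total_derivativeD F H L K :
  has_total_derivative F L -> has_total_derivative H K ->
  has_total_derivative (fun t x => F t x + H t x) (fun t x => L t x + K t x).
Proof.
move=> [cF [Ft [Fx [Ft_der Fx_der cFt cFx eqL]]]].
move=> [cH [Ht [Hx [Ht_der Hx_der cHt cHx eqK]]]].
split; first exact: jointly_continuous_onD.
exists (fun t x => Ft t x + Ht t x), (fun i t x => Fx i t x + Hx i t x).
split=> [t x Dt|t x i Dt|||t x Dt].
- by apply: has_derivative_onD; [exact: Ft_der|exact: Ht_der].
- by apply: is_deriveD; [exact: Fx_der|exact: Hx_der].
- exact: jointly_continuous_onD.
- by move=> i; exact: jointly_continuous_onD.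
- rewrite eqL // eqK // addrACA -big_split /=; congr (_ + _).
  by apply: eq_bigr => i _; rewrite mulrDr.
Qed.

(** The one-sided time derivative of a product requires one factor to be
    continuous in time along [D]; this comes from joint continuity on a slice of
    constant [x]. *)
Lemma total_derivativeM F H L K :
  has_total_derivative F L -> has_total_derivative H K ->
  has_total_derivative (fun t x => F t x * H t x)
    (fun t x => L t x * H t x + F t x * K t x).
Proof.
move=> [cF [Ft [Fx [Ft_der Fx_der cFt cFx eqL]]]].
move=> [cH [Ht [Hx [Ht_der Hx_der cHt cHx eqK]]]].
split; first exact: jointly_continuous_onM.
exists (fun t x => Ft t x * H t x + F t x * Ht t x),
  (fun i t x => Fx i t x * H t x + F t x * Hx i t x).
split=> [t x Dt|t x i Dt|||t x Dt].
- apply: has_derivative_onM; [|exact: Ft_der|exact: Ht_der].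
  have : {within D, continuous (fun s => F s x)}.
    by apply: (graph_continuous (g := cst x)) => // s; exact: cvg_cst.
  by move=> /subspace_continuousP; exact.
- apply: is_derive_eq; first by apply: is_deriveM; [exact: Fx_der|exact: Hx_der].
  by rewrite /GRing.scale /=; ring.
- by apply: jointly_continuous_onD; exact: jointly_continuous_onM.
- by move=> i; apply: jointly_continuous_onD; exact: jointly_continuous_onM.
- rewrite eqL // eqK // mulrDl mulrDr addrACA; congr (_ + _).
  rewrite mulr_suml mulr_sumr -big_split /=.
  by apply: eq_bigr => i _; ring.
Qed.

Lemma total_derivativeB F H L K :
  has_total_derivative F L -> has_total_derivative H K ->
  has_total_derivative (fun t x => F t x - H t x) (fun t x => L t x - K t x).
Proof.
move=> FL HK.
have NHK := total_derivativeM (total_derivative_cst (-1)) HK.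
by apply: (total_derivative_ext _ _ (total_derivativeD FL NHK)) => t x _ /=;
  rewrite ?mul0r ?add0r mulN1r.
Qed.

Lemma total_derivative_sum (I : Type) (r : seq I) (P : pred I)
    (F_ L_ : I -> R -> 'cV[R]_n -> R) :
  (forall i, P i -> has_total_derivative (F_ i) (L_ i)) ->
  has_total_derivative (fun t x => \sum_(i <- r | P i) F_ i t x)
    (fun t x => \sum_(i <- r | P i) L_ i t x).
Proof.
move=> FL; elim: r => [|i r IH].
  by apply: (total_derivative_ext _ _ (total_derivative_cst 0)) => t x _;
    rewrite big_nil.
have [Pi|nPi] := boolP (P i).
  by apply: (total_derivative_ext _ _ (total_derivativeD (FL i Pi) IH)) => t x _;
    rewrite big_cons Pi.
by apply: (total_derivative_ext _ _ IH) => t x _; rewrite big_cons (negbTE nPi).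
Qed.

Lemma total_derivative_time (g g' : R -> R) : {within D, continuous g'} ->
  (forall t, D t -> has_derivative_on D g t (g' t)) ->
  has_total_derivative (fun t _ => g t) (fun t _ => g' t).
Proof.
move=> cg' dg; split.
  apply: jointly_continuous_on_time; apply/subspace_continuousP => t Dt.
  exact: has_derivative_on_continuous (dg t Dt).
exists (fun t _ => g' t), (fun _ _ _ => 0); split=> [t x Dt|t x i Dt|||t x Dt].
- exact: dg.
- exact: is_derive_cst.
- exact: jointly_continuous_on_time.
- by move=> i; exact: jointly_continuous_on_cst.
- by rewrite big1 ?addr0 // => i _; rewrite mulr0.
Qed.

Lemma total_derivative_smooth_time (g g' : R -> R) : continuous g' ->
  (forall t : R, is_derive t (1 : R) g (g' t)) ->
  has_total_derivative (fun t _ => g t) (fun t _ => g' t).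
Proof.
move=> cg' dg; apply: total_derivative_time; first exact: continuous_subspaceT.
by move=> t _; exact: is_derive_has_derivative_on.
Qed.

Lemma total_derivative_dotv (w : 'cV[R]_n) :
  has_total_derivative (fun _ => dotv w) (fun t x => dotv w (A *m x + f t)).
Proof.
have cw : jointly_continuous_on (fun _ => dotv w).
  apply: continuous_subspaceT => p.
  by apply: (@continuous_comp _ _ _ snd (dotv w));
    [exact: cvg_snd|exact: continuous_dotv].
split=> //; exists (fun _ _ => 0), (fun i _ _ => w i 0).
split=> [t x Dt|t x i Dt|||t x Dt].
- by apply: is_derive_has_derivative_on; exact: is_derive_cst.
- apply: is_derive_eq; first exact: is_derive_dotv.
  rewrite /dotv (bigD1 i) //= big1 ?addr0; first by rewrite mxE !eqxx mulr1.
  by move=> j /negbTE ji; rewrite mxE ji mulr0.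
- exact: jointly_continuous_on_cst.
- by move=> i; exact: jointly_continuous_on_cst.
- by rewrite add0r; apply: eq_bigr => i _; rewrite mulrC.
Qed.

(** Since [p . (A x) = (A^T p) . x], the derivative along the homogeneous part of
    the system acts on the pair of coefficients [(p, q)] by [A^T - a] together
    with the infinitesimal rotation of speed [mu]. *)
Lemma total_derivative_rotating_form (a mu : R) (p q : 'cV[R]_n) :
  has_total_derivative (rotating_form a mu p q)
    (fun t x => rotating_form a mu (A^T *m p - a *: p + mu *: q)
                  (A^T *m q - a *: q - mu *: p) t x
                + rotating_form a mu p q t (f t)).
Proof.
(* Picked up by instance resolution for the compositions below. *)
have linD c t : is_derive t (1 : R) (fun s : R => c * s) c.
  apply: is_derive_eq
    (is_deriveM (is_derive_cst c t (1 : R)) (is_derive_id t (1 : R))) _.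
  by rewrite /GRing.scale /=; ring.
have lin_cont (c : R) : continuous (fun s : R => c * s) by exact: mulrl_continuous.
have dcos : has_total_derivative (fun t _ => cos (mu * t))
    (fun t _ => - sin (mu * t) * mu).
  apply: total_derivative_smooth_time => t.
  apply: cvgM; last exact: cvg_cst.
  by apply: cvgN; apply: continuous_comp; [exact: lin_cont|exact: continuous_sin].
have dsin : has_total_derivative (fun t _ => sin (mu * t))
    (fun t _ => cos (mu * t) * mu).
  apply: total_derivative_smooth_time => t.
  apply: cvgM; last exact: cvg_cst.
  by apply: continuous_comp; [exact: lin_cont|exact: continuous_cos].
have dexp : has_total_derivative (fun t _ => expR (- a * t))
    (fun t _ => expR (- a * t) * - a).
  apply: total_derivative_smooth_time => t.
  apply: cvgM; last exact: cvg_cst.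
  by apply: continuous_comp; [exact: lin_cont|exact: continuous_expR].
apply: (total_derivative_ext _ _ (total_derivativeM (total_derivativeD
  (total_derivativeM (total_derivative_dotv p) dcos)
  (total_derivativeM (total_derivative_dotv q) dsin)) dexp)) => // t x _.
rewrite /rotating_form !dotvDr !dotv_mulmx !dotvDl !dotvNl !dotvZl.
ring.
Qed.

(** By induction the [F_ j] with [j < k] are constants of the derivation, so
    that [k 'C(k-1, j) = (k - j) 'C(k, j)] turns the derivative of the sum into
    [k] times [\sum_(j < k) 'C(k-1, j) t ^ (k-1-j) F_ j], which the
    recursion at [k - 1] identifies with [k * H_ (k-1)]. *)
Lemma appell_first_integrals (N : nat) (H_ F_ : nat -> R -> 'cV[R]_n -> R) :
  (forall k, (k <= N)%N ->
     has_total_derivative (H_ k) (fun t x => k%:R * H_ k.-1 t x)) ->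
  (forall k t x, (k <= N)%N -> D t -> F_ k t x =
     H_ k t x - \sum_(0 <= j < k) 'C(k, j)%:R * t ^+ (k - j) * F_ j t x) ->
  forall k, (k <= N)%N -> has_total_derivative (F_ k) (fun _ _ => 0).
Proof.
move=> dH FE k; elim/ltn_ind: k => k IH kN.
have dX j : has_total_derivative (fun t _ => t ^+ j)
    (fun t _ => j%:R * t ^+ j.-1).
  elim: j => [|j IHj].
    apply: (total_derivative_ext _ _ (total_derivative_cst 1)) => // t x _.
    by rewrite mul0r.
  have d1 : has_total_derivative (fun t _ => t) (fun _ _ => 1).
    by apply: total_derivative_smooth_time => t; exact: cvg_cst.
  apply: (total_derivative_ext _ _ (total_derivativeM d1 IHj)) => t x _.
    by rewrite exprS.
  by case: j {IHj} => [|j] /=; rewrite ?exprS; ring.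
have dF (j : nat) : (j < k)%N -> has_total_derivative
    (fun t x => 'C(k, j)%:R * t ^+ (k - j) * F_ j t x)
    (fun t x => k%:R * ('C(k.-1, j)%:R * t ^+ (k.-1 - j) * F_ j t x)).
  move=> jk; have Fj := IH j jk (leq_trans (ltnW jk) kN).
  apply: (total_derivative_ext _ _ (total_derivativeM (total_derivativeM
    (total_derivative_cst 'C(k, j)%:R) (dX (k - j)%N)) Fj)) => // t x _.
  have kC : k%:R * 'C(k.-1, j)%:R = (k - j)%:R * 'C(k, j)%:R :> R.
    by rewrite -!natrM mul_bin_down.
  rewrite !mulrA kC -!subn1 subnAC; ring.
have dS := total_derivative_sum (index_iota 0 k) (P := fun j => (j < k)%N) dF.
apply: (total_derivative_ext _ _ (total_derivativeB (dH k kN) dS)) => t x Dt.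
  by rewrite FE // [in RHS]big_nat.
(* At [k.+1] the top term of the sum is [F_ k] itself, and the recursion at [k]
   shows that the whole sum is [H_ k]. *)
case: k kN {IH dF dS} => [|k] kN; first by rewrite mul0r big_nil subr0.
rewrite -[X in _ - X]big_nat -mulr_sumr -mulrBr big_nat_recr //= subnn expr0 binn !mul1r.
by rewrite (FE k) ?(ltnW kN) // addrCA subrr addr0 subrr mulr0.
Qed.

Lemma first_integral_of_total_derivative F : nondegenerate_interval D ->
  has_total_derivative F (fun _ _ => 0) -> is_first_integral A f D F.
Proof.
move=> Dnd [cF [Ft [Fx [Ft_der Fx_der cFt cFx eqL]]]].
have timeE t x : D t -> derive_on D (F^~ x) t = Ft t x.
  by move=> Dt; have [] := has_derivative_on_derivable Dnd Dt (Ft_der t x Dt).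
have spaceE t x i : D t -> pderive F i t x = Fx i t x.
  by move=> Dt; have [] := Fx_der t x i Dt.
split; first split.
- by move=> t x Dt; have [] := has_derivative_on_derivable Dnd Dt (Ft_der t x Dt).
- by move=> t x i Dt; have [] := Fx_der t x i Dt.
- apply: (@jointly_continuous_on_ext Ft (fun t x => derive_on D (F^~ x) t)) => //.
  by move=> t x Dt; rewrite timeE.
- move=> i; apply: (@jointly_continuous_on_ext (Fx i) (pderive F i)) => //.
  by move=> t x Dt; rewrite spaceE.
- move=> t x Dt; rewrite timeE // [RHS](eqL t x Dt); congr (_ + _).
  by apply: eq_bigr => i _; rewrite spaceE.
Qed.

End TotalDerivative.

(** * Generalized eigenvectors and the functions alpha *)

Section JordanChain.
Context {R : realType} {n : nat} (A : 'M[R]_n).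
Implicit Types (v : 'cV[R[i]]_n) (l : R[i]).

Lemma re_cV_mulmx v : re_cV (cmx_of_rmx A *m v) = A *m re_cV v.
Proof.
apply/matrixP => i j; rewrite !mxE.
rewrite (big_morph (@complex.Re R) (id1 := 0) (op1 := +%R)) //.
  by apply: eq_bigr => k _; rewrite !mxE;
    case: (v k j) => b c /=; rewrite mul0r subr0.
by case=> [? ?] [].
Qed.

Lemma im_cV_mulmx v : im_cV (cmx_of_rmx A *m v) = A *m im_cV v.
Proof.
apply/matrixP => i j; rewrite !mxE.
rewrite (big_morph (@complex.Im R) (id1 := 0) (op1 := +%R)) //.
  by apply: eq_bigr => k _; rewrite !mxE;
    case: (v k j) => b c /=; rewrite mul0r addr0.
by case=> [? ?] [].
Qed.

Lemma jordan_chain_re_im l (c : R) v v' :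
  (cmx_of_rmx A - l%:M) *m v = c%:C%C *: v' ->
  A *m re_cV v - complex.Re l *: re_cV v + complex.Im l *: im_cV v
    = c *: re_cV v' /\
  A *m im_cV v - complex.Re l *: im_cV v - complex.Im l *: re_cV v
    = c *: im_cV v'.
Proof.
rewrite mulmxBl mul_scalar_mx -re_cV_mulmx -im_cV_mulmx => E.
split; apply/matrixP => i j; have := congr1 (fun u : 'cV_n => u i j) E;
  rewrite !mxE; case: l {E} => a mu; case: (v i j) => b d; case: (v' i j) => b' d';
  case: (\sum_k _) => b'' d'' [] /=.
  by move=> + _; rewrite mul0r subr0 => <-; ring.
by move=> _; rewrite mul0r addr0 => <-; ring.
Qed.

End JordanChain.

(** The inhomogeneous equation whose forcing term is compensated by the iterated
    integrals.  At [k = 0] the hypothesis says that [nu 0] is an eigenvector,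
    because of the factor [k]. *)
Lemma total_derivative_alpha (R : realType) (n : nat) (A : 'M[R]_n)
    (f : R -> 'cV[R]_n) (D : set R) (l : R[i]) (nu : nat -> 'cV[R[i]]_n)
    (tau : 'I_2) (k : nat) :
  (cmx_of_rmx A^T - l%:M) *m nu k = k%:R *: nu k.-1 ->
  has_total_derivative A f D (alpha l nu tau k)
    (fun t x => k%:R * alpha l nu tau k.-1 t x + alpha l nu tau k t (f t)).
Proof.
rewrite -(rmorph_nat (real_complex R)) => /jordan_chain_re_im[reE imE].
rewrite /alpha; case: (tau == ord0).
  apply: (total_derivative_ext _ _ (total_derivative_rotating_form A f D
    (complex.Re l) (complex.Im l) (re_cV (nu k)) (im_cV (nu k)))) => // t x _.
  rewrite reE imE /rotating_form /alpha1 !dotvZl; ring.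
have {}reE : A^T *m - re_cV (nu k) - complex.Re l *: - re_cV (nu k)
    - complex.Im l *: im_cV (nu k) = - (k%:R *: re_cV (nu k.-1)).
  by rewrite -reE mulmxN scalerN !opprD !opprK.
have {}imE : A^T *m im_cV (nu k) - complex.Re l *: im_cV (nu k)
    + complex.Im l *: - re_cV (nu k) = k%:R *: im_cV (nu k.-1).
  by rewrite -imE scalerN.
apply: (total_derivative_ext _ _ (total_derivative_rotating_form A f D
  (complex.Re l) (complex.Im l) (im_cV (nu k)) (- re_cV (nu k)))) => t x _.
  by rewrite /rotating_form /alpha2 dotvNl mulNr.
rewrite reE imE /rotating_form /alpha2 !dotvNl !dotvZl; ring.
Qed.

(** * The first integrals *)

Theorem theorem3p12 (R : realType) (n : nat) (A : 'M[R]_n)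
    (J : set R) (f : R -> 'cV[R]_n)
    (J_itv : is_interval J)
    (f_cont : {within J, continuous f})
    (lambda : R[i]) (m : nat) (nu : nat -> 'cV[R[i]]_n)
    (lambda_im : complex.Im lambda != 0)
    (m_ge2 : (2 <= m)%N)
    (lambda_eldiv : has_elementary_divisor (cmx_of_rmx A^T) lambda m)
    (nu0_eigen : is_eigenvector (cmx_of_rmx A^T) lambda (nu 0%N))
    (nu_gen : forall k : nat, (1 <= k <= m - 1)%N ->
       is_generalized_eigenvector (cmx_of_rmx A^T) lambda nu k)
    (Jt : set R)
    (Jt_itv : nondegenerate_interval Jt)
    (Jt_sub : Jt `<=` J)
    (G : 'I_2 -> nat -> R -> R)
    (G_base : forall tau : 'I_2,
       is_antiderivative_on Jt
         (fun t => alpha lambda nu tau 0%N t (f t)) (G tau 0%N))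
    (G_rec : forall (tau : 'I_2) (k : nat), (1 <= k <= m - 1)%N ->
       is_antiderivative_on Jt
         (fun t => alpha lambda nu tau k t (f t) + k%:R * G tau (k - 1)%N t)
         (G tau k))
    (F : 'I_2 -> nat -> R -> 'cV[R]_n -> R)
    (F_base : forall (tau : 'I_2) (t : R) (x : 'cV[R]_n), Jt t ->
       F tau 1%N t x = alpha lambda nu tau 0%N t x - G tau 0%N t)
    (F_rec : forall (tau : 'I_2) (k : nat) (t : R) (x : 'cV[R]_n),
       (1 <= k <= m - 1)%N -> Jt t ->
       F tau (k + 1)%N t x =
         alpha lambda nu tau k t x
         - \sum_(0 <= xi < k) 'C(k, xi)%:R * t ^+ (k - xi) * F tau (xi + 1)%N t x
         - G tau k t) :
  (forall tau : 'I_2, is_first_integral A f Jt (F tau 1%N)) /\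
  (forall (tau : 'I_2) (k : nat), (1 <= k <= m - 1)%N ->
     is_first_integral A f Jt (F tau (k + 1)%N)).
Proof.
have nu_chain k : (k <= m - 1)%N ->
    (cmx_of_rmx A^T - lambda%:M) *m nu k = k%:R *: nu k.-1.
  case: k => [_|k km]; last by have [] := nu_gen k.+1 km.
  have [_ eig] := nu0_eigen.
  by rewrite mulmxBl mul_scalar_mx eig subrr scale0r.
have f_contJt : {within Jt, continuous f} := continuous_subspaceW Jt_sub f_cont.
pose H tau k t x := alpha lambda nu tau k t x - G tau k t.
(* At [k = 0] the spurious term [G tau 0.-1] is killed by the factor [k]. *)
have G_anti tau k : (k <= m - 1)%N -> is_antiderivative_on Jt
    (fun t => alpha lambda nu tau k t (f t) + k%:R * G tau k.-1 t) (G tau k).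
  case: k => [_ t Jt_t|k km]; last by have := G_rec tau k.+1 km; rewrite subn1.
  by rewrite mul0r addr0; exact: G_base.
have G_cont tau k : (k <= m - 1)%N -> {within Jt, continuous (G tau k)}.
  move=> km; apply/subspace_continuousP => t Jt_t.
  exact: has_derivative_on_continuous
    (antiderivative_has_derivative_on (G_anti tau k km) Jt_t).
have H_appell tau k : (k <= m - 1)%N -> has_total_derivative A f Jt (H tau k)
    (fun t x => k%:R * H tau k.-1 t x).
  move=> km; have dalpha := total_derivative_alpha f Jt tau (nu_chain k km).
  have alpha_f_cont : {within Jt, continuous (fun t => alpha lambda nu tau k t (f t))}.
    exact: graph_continuous dalpha.1 f_contJt.
  have dG := @total_derivative_time R n A f Jt (G tau k) _ _
    (fun t => antiderivative_has_derivative_on (G_anti tau k km)).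
  apply: (total_derivative_ext _ _ (total_derivativeB dalpha (dG _))) => //.
    by move=> t x _; rewrite /H; ring.
  move=> t; apply: cvgD; first exact: alpha_f_cont.
  apply: cvgM; first exact: cvg_cst.
  by apply: G_cont; exact: leq_trans (leq_pred k) km.
have F_int tau k : (k <= m - 1)%N -> is_first_integral A f Jt (F tau k.+1).
  move=> km; apply: (first_integral_of_total_derivative Jt_itv).
  apply: (@appell_first_integrals _ _ A f Jt (m - 1) (H tau) (fun k => F tau k.+1)) => //.
    exact: H_appell.
  move=> [|j] t x jm Jt_t; first by rewrite F_base // big_nil subr0.
  rewrite -[j.+2]addn1 F_rec // /H addrAC; congr (_ - _).
  by apply: eq_bigr => i _; rewrite addn1.
split=> [tau|tau k /andP[_ km]]; first exact: F_int.
by rewrite addn1; exact: F_int.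
Qed.
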